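(* Let $1\le p<q\le\infty$ and $K>1$. For any $\varepsilon>0$ and $\delta\in(0,1)$, the minimal fixed cost of i.i.d.-based algorithms on $\mathcal Y_{p,q,K}$ satisfies $$\bar n^{\mathrm{fix}}(\varepsilon,\delta,\mathcal Y_{p,q,K})\ \ge\ \frac1{2\log2}\,K^{pq/(q-p)}\,\log\delta^{-1}.$$
   Context: Random variables are real-valued on a probability space $(\Omega,\Sigma,\mathbb P)$, assumed rich enough to carry all random variables considered (random variables with arbitrary distributions, sequences of i.i.d. copies, independent auxiliary randomness). $\|X\|_q=(\mathbb E|X|^q)^{1/q}$ for $q<\infty$ and $\|X\|_\infty$ is the essential supremum of $|X|$. For $1\le p<q\le\infty$ and $K>1$, $$\mathcal Y_{p,q,K}:=\{Y\in L_q\mid \|Y-\mathbb E Y\|_q\le K\|Y-\mathbb E Y\|_p\}.$$ For $q=\infty$, $pq/(q-p)$ is read as $p$. An i.i.d.-based algorithm on a class $\mathcal Y$ of random variables consists of: an auxiliary random variable $U$ with values in a measurable space $(\mathbb U,\Sigma_U)$; a measurable $\phi:\mathbb U\times\mathbb R^{\mathbb N}\to\mathbb R$; and a measurable stopping rule $n:\mathbb U\times\mathbb R^{\mathbb N}\to\mathbb N_0\cup\{\infty\}$ such that whether $n(u,(y_j)_j)\ge i$ depends only on $(u,y_1,\dots,y_{i-1})$. For $Y\in\mathcal Y$ with i.i.d. copies $(Y_i)_{i\in\mathbb N}$, independent of $U$, put $n(\omega,Y):=n(U(\omega),(Y_i(\omega))_i)$, assumed almost surely finite for each $Y\in\mathcal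 Y$, and $A(\omega,Y):=\phi(U(\omega),Y_1(\omega),\dots,Y_{n(\omega,Y)}(\omega),0,0,\dots)$; $A(Y):=A(\cdot,Y)$. The algorithm is $(\varepsilon,\delta)$-approximating on $\mathcal Y$ if $\mathbb P\{|A(Y)-\mathbb E Y|\le\varepsilon\}\ge1-\delta$ for all $Y\in\mathcal Y$. The expected cost is $\bar n(A,Y):=\mathbb E\,n(\cdot,Y)$, the fixed cost is $\bar n^{\mathrm{fix}}(A,\mathcal Y):=\inf_{Y\in\mathcal Y}\bar n(A,Y)$, and the minimal fixed cost is $$\bar n^{\mathrm{fix}}(\varepsilon,\delta,\mathcal Y):=\inf\{n>0\mid\exists\ (\varepsilon,\delta)\text{-approximating i.i.d.-based } A \text{ on }\mathcal Y\text{ with }\bar n^{\mathrm{fix}}(A,\mathcal Y)\le n\}.$$ *)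

(* Defs.v *)
From HB Require Import structures.
From mathcomp Require Import all_boot all_order all_algebra.
From mathcomp Require Import all_classical all_reals all_analysis measurable_realfun.

Set Implicit Arguments.
Unset Strict Implicit.
Unset Printing Implicit Defensive.

Import Order.TTheory GRing.Theory Num.Theory.
Import numFieldNormedType.Exports.

Local Open Scope classical_set_scope.
Local Open Scope ring_scope.
Local Open Scope ereal_scope.

(* R^N with the product sigma-algebra.  Sequences are indexed from 0, so the
   usual y_1, y_2, ... are y 0, y 1, ... throughout. *)
Definition cylinders (R : realType) : set (set (nat -> R)) :=
  [set C | exists (i : nat) (B : set R),
     measurable B /\ C = [set y | B (y i)]].

Arguments cylinders R : clear implicits.

Notation seqR R := (g_sigma_algebraType (cylinders R)).

Section RandomVariables.
Context {d : measure_display} {T : measurableType d} {R : realType}.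
Variable P : probability T R.

Definition centered (Y : {RV P >-> R}) (w : T) : R := (Y w - fine 'E_P[Y])%R.

Definition moment_class (p : R) (q : \bar R) (K : R) : set {RV P >-> R} :=
  [set Y : {RV P >-> R} | (Y : T -> R) \in Lfun P q /\
     'N[P]_q[EFin \o centered Y] <=
       K%:E * 'N[P]_(p%:E)[EFin \o centered Y]].

Definition carries_all_laws : Prop :=
  forall mu : probability (measurableTypeR R) R, exists Y : {RV P >-> R},
    forall B : set R, measurable B -> distribution P Y B = mu B.

Definition identically_distributed (Y : {RV P >-> R})
    (Z : nat -> {RV P >-> R}) : Prop :=
  forall (i : nat) (B : set R), measurable B ->
    distribution P (Z i) B = distribution P Y B.

Definition mutually_independent (Z : nat -> {RV P >-> R}) : Prop :=
  forall (J : seq nat) (B : nat -> set R), uniq J ->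
    (forall i, measurable (B i)) ->
    P (\big[setI/setT]_(i <- J) (Z i @^-1` B i)) =
    \prod_(i <- J) P (Z i @^-1` B i).

Definition sample_path (Z : nat -> {RV P >-> R}) (w : T) : seqR R :=
  fun i => Z i w.

Definition independent_of_sequence {dU : measure_display}
    {S : measurableType dU} (U : {RV P >-> S})
    (Z : nat -> {RV P >-> R}) : Prop :=
  forall (A : set S) (B : set (seqR R)), measurable A -> measurable B ->
    P (U @^-1` A `&` sample_path Z @^-1` B) =
    P (U @^-1` A) * P (sample_path Z @^-1` B).

Definition iid_copies {dU : measure_display} {S : measurableType dU}
    (U : {RV P >-> S}) (Y : {RV P >-> R}) (Z : nat -> {RV P >-> R}) : Prop :=
  [/\ identically_distributed Y Z, mutually_independent Z &
      independent_of_sequence U Z].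

End RandomVariables.

Arguments moment_class {d T R} P p q K _.

(* N_0 u {oo} is [option nat], with [None] for oo. *)
Definition reaches (m : option nat) (i : nat) : bool :=
  if m is Some k then (i <= k)%N else true.

Definition sample_count (R : realType) (m : option nat) : \bar R :=
  if m is Some k then k%:R%:E else +oo.

Definition truncate (R : realType) (m : option nat) (y : seqR R) : seqR R :=
  fun j => if reaches m j.+1 then y j else 0%R.

Section Algorithms.
Context {d : measure_display} {T : measurableType d} {R : realType}.
Variable P : probability T R.

(* [alg_room] is the assumption that the probability space is rich enough for
   i.i.d. copies independent of the auxiliary variable.  It has to be stated
   relative to [alg_aux]: on no space are there nonconstant copies independent
   of every random element (take the identity). *)
Record iid_algorithm (C : set {RV P >-> R}) := IidAlgorithm {
  alg_display : measure_display;
  alg_space : measurableType alg_display;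
  alg_aux : {RV P >-> alg_space};
  alg_phi : alg_space * seqR R -> R;
  alg_stop : alg_space * seqR R -> option nat;
  alg_phi_measurable : measurable_fun setT alg_phi;
  alg_stop_measurable : measurable_fun setT (sample_count R \o alg_stop);
  alg_stop_nonanticipating :
    forall (u : alg_space) (y z : seqR R) (i : nat),
      (forall j, (j < i)%N -> y j = z j) ->
      reaches (alg_stop (u, y)) i.+1 = reaches (alg_stop (u, z)) i.+1;
  alg_room : forall Y, C Y -> exists Z, iid_copies alg_aux Y Z;
  alg_stop_finite : forall Y Z, C Y -> iid_copies alg_aux Y Z ->
    {ae P, forall w, alg_stop (alg_aux w, sample_path Z w) <> None}
}.

Arguments alg_phi {C} A _ : rename.
Arguments alg_stop {C} A _ : rename.

Variable C : set {RV P >-> R}.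

Definition used_samples (A : iid_algorithm C) (Z : nat -> {RV P >-> R})
    (w : T) : option nat :=
  alg_stop A (alg_aux A w, sample_path Z w).

Definition output (A : iid_algorithm C) (Z : nat -> {RV P >-> R})
    (w : T) : R :=
  alg_phi A (alg_aux A w, truncate (used_samples A Z w) (sample_path Z w)).

Definition approximating (eps delta : R) (A : iid_algorithm C) : Prop :=
  forall Y Z, C Y -> iid_copies (alg_aux A) Y Z ->
    (1 - delta)%:E <=
    P [set w | (`|output A Z w - fine 'E_P[Y]| <= eps)%R].

Definition expected_cost (A : iid_algorithm C) (Z : nat -> {RV P >-> R}) :
    \bar R :=
  \int[P]_w sample_count R (used_samples A Z w).

(* The expected cost on Y does not depend on which copies Z of Y are used. *)
Definition fixed_cost (A : iid_algorithm C) : \bar R :=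
  ereal_inf [set c | exists Y Z,
    [/\ C Y, iid_copies (alg_aux A) Y Z & c = expected_cost A Z]].

Definition minimal_fixed_cost (eps delta : R) : \bar R :=
  ereal_inf [set n%:E | n in [set n : R | (0 < n)%R /\
    exists A : iid_algorithm C,
      approximating eps delta A /\ fixed_cost A <= n%:E]].

End Algorithms.

Definition rate_exponent (R : realType) (p : R) (q : \bar R) : R :=
  if q is q'%:E then (p * q' / (q' - p))%R else p.

(* Main.v *)
(* Fix an input Y of the class and let Y' have the law (1 - a) law(Y) + a dirac(m),
   a rare spike at a remote point m.  As m tends to infinity, Y' / m looks like a
   Bernoulli(a) variable, whose norm ratio is below K when a = min(1/2, K^(-r))
   with r = pq / (q - p); hence Y' belongs to the class for all large m.  On the
   event that no spike is sampled, which has conditional probability (1 - a)^n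
   given n samples, the algorithm behaves on Y' as on Y, so its output stays
   bounded while E Y' goes to infinity, and it fails.  Letting m tend to infinity
   gives E (1 - a)^n <= delta for the sample count n on Y, whence
   E n >= ln (1/delta) / (- ln (1 - a)) by Jensen's inequality, and
   - ln (1 - a) <= 2 a ln 2 because a <= 1/2. *)

Require Import Defs.
From HB Require Import structures.
From mathcomp Require Import all_boot all_order all_algebra.
From mathcomp Require Import all_classical all_reals all_analysis measurable_realfun.
From mathcomp Require Import ess_sup_inf.
From mathcomp Require Import ring lra.

Import Order.TTheory GRing.Theory Num.Theory.
Import numFieldNormedType.Exports.

Local Open Scope classical_set_scope.
Local Open Scope ring_scope.

Set Implicit Arguments.
Unset Strict Implicit.
Unset Printing Implicit Defensive.

(** * Norms of centered Bernoulli variables and the weight of the spike *)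

Section bernoulli_norm.
Context {R : realType}.
Implicit Types (a p q s K : R).

(* The L_q-norm of a centered Bernoulli(a) variable; at q = +oo the value 1 - a
   is correct only for a <= 1/2. *)
Definition bernoulli_norm (a : R) (q : \bar R) : R :=
  if q is s%:E then ((1 - a) * a `^ s + a * (1 - a) `^ s) `^ s^-1 else 1 - a.

Lemma bernoulli_norm_gt0 a (q : \bar R) :
  0 < a -> a < 1 -> 0 < bernoulli_norm a q.
Proof.
move=> a0 a1; have c0 : 0 < 1 - a by rewrite subr_gt0.
by case: q => [s| |] //=; rewrite powR_gt0// addr_gt0// mulr_gt0// powR_gt0.
Qed.

Lemma bernoulli_norm_half s : s != 0 -> bernoulli_norm 2^-1 s%:E = 2^-1.
Proof.
move=> s0 /=; rewrite (_ : 1 - 2^-1 = 2^-1 :> R); last by field.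
rewrite -mulrDl (_ : 2^-1 + 2^-1 = 1 :> R); last by field.
by rewrite mul1r -powRrM mulfV// powRr1.
Qed.

Lemma powR_lt1_anti s p q : 0 < s -> s < 1 -> p < q -> s `^ q < s `^ p.
Proof.
move=> s0 s1 pq; rewrite /powR gt_eqF// ltr_expR.
by rewrite ltr_nM2r// ln_lt0// s0.
Qed.

Lemma powRVK s p : 0 < s -> p != 0 -> (s `^ p^-1) `^ p = s.
Proof. by move=> s0 p0; rewrite -powRrM mulVf// powRr1// ltW. Qed.

(* The weights 1 and (1 - a) / a are at least 1, so the weighted l_s norm of
   (1 - a, a) is strictly decreasing in s. *)
Lemma bernoulli_norm_lt a p (q : \bar R) :
    0 < a -> a <= 2^-1 -> 0 < p -> (p%:E < q)%E ->
  bernoulli_norm a q < (a^-1) `^ (rate_exponent p q)^-1 * bernoulli_norm a p%:E.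
Proof.
move=> a0 a2 p0 pq; have a1 : a < 1 by rewrite (le_lt_trans a2)// invf_lt1 ?ltr1n.
set c := 1 - a; have c0 : 0 < c by rewrite subr_gt0.
have ac : a <= c by rewrite /c; lra.
have ca1 : 1 <= c / a by rewrite ler_pdivlMr// mul1r.
have ca0 : 0 < c / a by rewrite divr_gt0.
pose W s := c `^ s + c / a * a `^ s.
have W0 s : 0 < W s.
  by apply: addr_gt0; [exact: powR_gt0|exact: mulr_gt0 ca0 (powR_gt0 _ _)].
have bE s : c * a `^ s + a * c `^ s = a * W s.
  by rewrite /W; field; rewrite gt_eqF.
(* [s] is the weighted l_p norm of [(c, a)]. Both [c / s] and [a / s] are below 1, so passing from
   [p] to [q] shrinks every term of the normalised sum, which is 1 at [p]. *)
pose s := W p `^ p^-1; have s0 : 0 < s by rewrite powR_gt0.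
have Wp : W p = s `^ p by rewrite powRVK// gt_eqF.
have cs : c < s.
  rewrite ltNge; apply/negP => sc.
  have : s `^ p <= c `^ p by rewrite ge0_ler_powR ?nnegrE// ltW.
  by rewrite -Wp /W gerDl leNgt mulr_gt0// powR_gt0.
have as_ : a < s by exact: le_lt_trans cs.
have bpE : bernoulli_norm a p%:E = a `^ p^-1 * s.
  by rewrite /= -/c bE powRM// ltW.
have pn0 : p != 0 by rewrite gt_eqF.
(* At [q = +oo] the rate exponent is [p], the powers of [a] cancel, and [c < s] remains. *)
rewrite bpE; case: q pq => [q|_|//] /=; last first.
  by rewrite mulrA -powRM ?invr_ge0 ?(ltW a0)// mulVf ?gt_eqF// powR1 mul1r.
rewrite lte_fin => pq; have q0 : 0 < q by exact: lt_trans pq.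
have qn0 : q != 0 by rewrite gt_eqF.
have Wq : W q < s `^ q.
  have sc x r : 0 < x -> x `^ r = s `^ r * (x / s) `^ r.
    by move=> x0; rewrite -powRM ?divr_ge0 ?ltW// mulrC divfK// gt_eqF.
  have : W p / s `^ p = 1 by rewrite Wp divff// gt_eqF// powR_gt0.
  rewrite /W (sc c p)// (sc a p)// (sc c q)// (sc a q)//.
  rewrite mulrCA -mulrDr mulrAC mulfV ?gt_eqF ?powR_gt0// mul1r => h.
  rewrite mulrCA -mulrDr gtr_pMr ?powR_gt0// -h ltrD//.
    by rewrite powR_lt1_anti// ?divr_gt0// ltr_pdivrMr// mul1r.
  by rewrite ltr_pM2l// powR_lt1_anti// ?divr_gt0// ltr_pdivrMr// mul1r.
rewrite bE powRM ?ltW//.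
(* This exponent turns the prefactor [a^(1/p)] of the p-norm into the prefactor [a^(1/q)] of the
   q-norm. *)
have -> : (p * q / (q - p))^-1 = p^-1 - q^-1.
  by field; rewrite pn0 qn0 subr_eq0 gt_eqF.
rewrite -(powR_inv1 (ltW a0)) -powRrM mulrA -powRD ?(gt_eqF a0) ?implybT//.
rewrite (_ : -1 * _ + _ = q^-1); last by ring.
rewrite ltr_pM2l ?powR_gt0//.
have -> : s = (s `^ q) `^ q^-1 by rewrite -powRrM mulfV// powRr1// ltW.
by rewrite gt0_ltr_powR ?invr_gt0// ?nnegrE ltW// powR_gt0.
Qed.

Lemma rate_exponent_gt0 p (q : \bar R) :
  0 < p -> (p%:E < q)%E -> 0 < rate_exponent p q.
Proof.
move=> p0; case: q => [q| |] //=; rewrite lte_fin => pq.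
by rewrite divr_gt0 ?subr_gt0// mulr_gt0// (lt_trans p0).
Qed.

(** The weight is [min(1/2, K^(-r))]. At 1/2 the gap is just [1 < K]; below 1/2 the norm ratio is
    less than [a^(-1/r) = K]. Strictness later absorbs the fluctuations of [Y]. *)
Lemma exists_heavy_weight p (q : \bar R) K :
    0 < p -> (p%:E < q)%E -> 1 < K ->
  exists a, [/\ 0 < a, a <= 2^-1, K `^ rate_exponent p q <= a^-1 &
    bernoulli_norm a q < K * bernoulli_norm a p%:E].
Proof.
move=> p0 pq K1; have K0 : 0 < K by exact: lt_trans K1.
have r0 := rate_exponent_gt0 p0 pq; set r := rate_exponent p q in r0 *.
have [Kr|Kr] := leP (K `^ r) 2.
- exists 2^-1; split; rewrite ?invr_gt0 ?invrK//.
  rewrite bernoulli_norm_half ?gt_eqF// (_ : bernoulli_norm _ _ = 2^-1).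
    by rewrite ltr_pMl// invr_gt0.
  case: q pq {r r0 Kr} => [q| |] //; last by rewrite /=; lra.
  by rewrite lte_fin => pq; rewrite bernoulli_norm_half// gt_eqF// (lt_trans p0).
- exists (K `^ r)^-1; have Kr0 : 0 < K `^ r by rewrite powR_gt0.
  have a2 : (K `^ r)^-1 <= 2^-1 by rewrite lef_pV2 ?posrE// ltW.
  split; rewrite ?invr_gt0 ?invrK//.
  have := bernoulli_norm_lt _ a2 p0 pq; rewrite invr_gt0 => /(_ Kr0).
  by rewrite invrK -/r -powRrM mulfV ?gt_eqF// powRr1// ltW.
Qed.

(** Concavity of [ln] on [[1/2, 1]]: the point [1 - a] is the average of 1/2 and 1 with weights
    [2 * a] and [1 - 2 * a]. *)
Lemma oppr_ln_onem_le a : 0 <= a -> a <= 2^-1 -> - ln (1 - a) <= 2 * ln 2 * a.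
Proof.
move=> a0 a2; have b0 : 0 <= 2 * a by rewrite mulr_ge0.
have b1 : 2 * a <= 1 by lra.
have h0 : 0 < 2^-1 :> R by rewrite invr_gt0.
have := @concave_ln _ (Itv01 b0 b1) _ _ h0 (@ltr01 R).
rewrite !convRE/= /unstable.onem ln1 mulr0 addr0 lnV ?posrE// => h.
rewrite (_ : 1 - a = 2 * a / 2 + (1 - 2 * a) * 1); last by field.
by move: h; lra.
Qed.
End bernoulli_norm.

(** * Mixing a law with a point mass *)

Section spiked.
Context {d : measure_display} {T : measurableType d} {R : realType}.
Variable P : probability T R.

Section spiked_measure.
Variables (mu : probability R R) (a m : R).
Hypotheses (a0 : 0 <= a) (a1 : 0 <= 1 - a).

Definition spiked_measure :=
  measure_add (mscale (NngNum a1) mu)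
    (mscale (NngNum a0) \d_m).

HB.instance Definition _ := Measure.on spiked_measure.

Let spiked_measure_setT : spiked_measure [set: _] = 1%E.
Proof.
rewrite /spiked_measure measure_addE /= /mscale/=.
rewrite probability_setT diracT.
by rewrite !mule1 -EFinD subrK.
Qed.

HB.instance Definition _ :=
  Measure_isProbability.Build _ _ _ spiked_measure spiked_measure_setT.

End spiked_measure.

(* [carries_all_laws] ranges over laws on [measurableTypeR R], whose display is
   not the one of the canonical structure on [R]. *)
Definition to_measurableTypeR (x : R) : measurableTypeR R := x.

HB.instance Definition _ := @isMeasurableFun.Build _ _ _ _
  to_measurableTypeR (@measurable_id _ _ setT).

(** Only the law of [Y'] is prescribed, with no coupling to [Y]: an algorithm sees a variable only
    through copies of it. *)
Definition spiked (a m : R) (Y Y' : {RV P >-> R}) :=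
  forall B : set R, measurable B ->
    distribution P Y' B =
    ((1 - a)%:E * distribution P Y B + a%:E * \d_m B)%E.

Lemma exists_spiked a m (Y : {RV P >-> R}) : carries_all_laws P ->
  0 <= a -> a <= 1 -> exists Y', spiked a m Y Y'.
Proof.
move=> rich a0; rewrite -subr_ge0 => a1.
have [Y' Y'E] := rich
  (distribution (spiked_measure (distribution P Y) m a0 a1) to_measurableTypeR).
by exists Y' => B mB; rewrite Y'E//; exact: measure_addE.
Qed.

Section spiked_theory.
Variables (a m : R) (Y Y' : {RV P >-> R}).
Hypotheses (a0 : 0 <= a) (a1 : a <= 1) (YY' : spiked a m Y Y').

Lemma ge0_integral_spiked (g : R -> \bar R) :
    measurable_fun setT g -> (forall x, 0 <= g x)%E ->
  (\int[P]_w g (Y' w) =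
   (1 - a)%:E * \int[P]_w g (Y w) + a%:E * g m)%E.
Proof.
move=> mg g0; have c0 : 0 <= 1 - a by rewrite subr_ge0.
rewrite -(ge0_integral_distribution Y' mg g0) -(ge0_integral_distribution Y mg g0).
rewrite (eq_measure_integral (spiked_measure (distribution P Y) m a0 c0)); last first.
  move=> A mA _; rewrite /= YY'//; exact/esym/measure_addE.
rewrite ge0_integral_measure_add// !ge0_integral_mscale//= integral_dirac//.
by rewrite diracT mul1e.
Qed.

Lemma spiked_expectation : (Y : T -> R) \in Lfun P 1 -> 0 <= m ->
  fine 'E_P[Y'] = (1 - a) * fine 'E_P[Y] + a * m.
Proof.
move=> /Lfun1_integrable iY m0; rewrite unlock.
have mE : measurable_fun setT (@EFin R) by exact/measurable_EFinP.
have mp : measurable_fun setT (fun x : R => maxe x%:E 0%E).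
  exact: measurable_maxe.
have mn : measurable_fun setT (fun x : R => maxe (- x%:E) 0)%E.
  by apply: measurable_maxe => //; exact: measurableT_comp.
have p0 (x : R) : (0 <= maxe x%:E 0%E)%E by rewrite le_max lexx orbT.
have n0 (x : R) : (0 <= maxe (- x%:E) 0)%E by rewrite le_max lexx orbT.
rewrite integralE [in RHS]integralE.
have fp := integrable_pos_fin_num (measurableT) iY.
have fn := integrable_neg_fin_num (measurableT) iY.
rewrite !unlock /= in fp fn *.
rewrite (ge0_integral_spiked mp p0) (ge0_integral_spiked mn n0).
(* As [m] is nonnegative, the spike contributes to the positive part only. *)
rewrite (_ : maxe m%:E 0 = m%:E)%E; last by apply/max_idPl; rewrite lee_fin.
rewrite (_ : maxe (- m%:E) 0 = 0)%E; last by apply/max_idPr; rewrite leeNl oppe0 lee_fin.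
rewrite -(fineK fp) -(fineK fn) mule0 adde0 -!EFinM -EFinD -!EFinB /=.
by ring.
Qed.

Lemma spiked_ess_sup_le e x :
    (ess_sup P (fun w => `|Y w - e|%:E) <= x%:E)%E -> `|m - e| <= x ->
  (ess_sup P (fun w => `|Y' w - e|%:E) <= x%:E)%E.
Proof.
move=> /ess_supP Yx mx; apply/ess_supP.
pose h z := `|z - e|%:E.
have mh : measurable_fun setT h.
  apply/measurable_EFinP; apply: measurableT_comp => //.
  exact: measurable_funB.
have mB : measurable (h @^-1` `]x%:E, +oo[).
  by rewrite -[X in measurable X]setTI; apply: mh => //; exact: emeasurable_itv.
have mhY (Z : {RV P >-> R}) : measurable_fun setT (h \o Z).
  by apply: (measurableT_comp mh); exact: measurable_funPT.
apply/(ae_le_measureP P x%:E (mhY Y')).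
move/(ae_le_measureP P x%:E (mhY Y)) : Yx.
(* The point mass does not charge the set where [|z - e| > x], because [|m - e| <= x]. *)
have := YY' mB; rewrite /distribution /pushforward /= => -> ->.
rewrite mule0 add0e diracE memNset ?mule0//=.
by rewrite in_itv/= andbT lte_fin ltNge mx.
Qed.

Lemma spiked_Lnorm e s : 0 < s ->
  ('N[P]_s%:E[EFin \o (fun w => Y' w - e)%R] `^ s =
   (1 - a)%:E * 'N[P]_s%:E[EFin \o (fun w => Y w - e)%R] `^ s +
   (a * `|m - e| `^ s)%:E)%E.
Proof.
move=> s0; rewrite !poweR_Lnorm ?gt_eqF//.
pose h z := (`|(z - e)%:E| `^ s)%E.
have mh : measurable_fun setT h.
  rewrite /h; under eq_fun do rewrite abse_EFin poweR_EFin.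
  apply/measurable_EFinP.
  apply: (@measurableT_comp _ _ _ _ _ _ (@powR R ^~ s)) => //.
  by apply: measurableT_comp => //; exact: measurable_funB.
by rewrite (ge0_integral_spiked mh)// => z; exact: poweR_ge0.
Qed.

End spiked_theory.
End spiked.

(** * Membership of remotely spiked variables in the moment class *)

Section moment_class_spiked.
Context {d : measure_display} {T : measurableType d} {R : realType}.
Variable P : probability T R.

Lemma Lnorm1_le (X : T -> R) p : measurable_fun setT X -> 1 <= p ->
  ('N[P]_1[EFin \o X] <= 'N[P]_(p%:E)[EFin \o X])%E.
Proof.
move=> mX; rewrite le_eqVlt => /predU1P[<-//|p1].
have p0 : 0 < p by exact: lt_trans p1.
(* Hölder against the constant 1, which has norm 1 under a probability. The other exponent is the
   conjugate of [p], finite since [p = 1] has been split off. *)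
have := @hoelder _ _ _ P X (cst 1) p (1 - p^-1)^-1 mX (measurable_cst _) p0.
rewrite invr_gt0 invrK subr_gt0 invf_lt1// p1 subrKC => /(_ isT erefl).
rewrite (_ : X \* cst 1 = X); last by apply/funext => x; rewrite /= mulr1.
by rewrite Lnorm_cst1 /= probability_setT poweR1r mule1.
Qed.

Lemma Lnorm_cst (e : R) (q : \bar R) : (1 <= q)%E ->
  ('N[P]_q[EFin \o cst e] = `|e|%:E)%E.
Proof.
case: q => [q q1| _|//].
  have q0 : 0 < q by rewrite (lt_le_trans ltr01).
  rewrite unlock /=.
  rewrite integral_cst//= probability_setT mule1 poweR_EFin -powRrM mulfV ?gt_eqF//.
  by rewrite powRr1.
rewrite unlock /= probability_setT lte01 (_ : _ \o _ = cst `|e|%:E)//.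
by rewrite ess_sup_cst//= probability_setT lte01.
Qed.

Lemma poweRKV (x : \bar R) s : (0 <= x)%E -> s != 0 -> ((x `^ s) `^ s^-1 = x)%E.
Proof. by move=> x0 s0; rewrite -poweRrM mulfV// poweRe1. Qed.

Section fixed_spike.
Variables (a m : R) (Y Y' : {RV P >-> R}).
Hypotheses (a0 : 0 < a) (a2 : a <= 2^-1) (YY' : spiked a m Y Y').

Let a1 : a < 1. Proof. by rewrite (le_lt_trans a2)// invf_lt1 ?ltr1n. Qed.
Let c0 : 0 < 1 - a. Proof. by rewrite subr_gt0. Qed.

Lemma bernoulli_norm_scale s u : 0 < s -> 0 <= u ->
  ((1 - a) * (u * a) `^ s + a * (u * (1 - a)) `^ s) `^ s^-1 =
  u * bernoulli_norm a s%:E.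
Proof.
move=> s0 u0; rewrite !powRM ?(ltW a0) ?(ltW c0)// /=.
rewrite mulrCA [a * _]mulrCA -mulrDr powRM ?powR_ge0//; last first.
  by rewrite addr_ge0// mulr_ge0 ?powR_ge0 ?ltW.
by rewrite -powRrM mulfV ?gt_eqF// powRr1.
Qed.

(** A centered Bernoulli(a) variable scaled by [u] is at distance [u * a] from 0 with probability
    [1 - a] and at distance [u * (1 - a)] with probability [a]. The norm of [Y - e] replaces the
    first distance, [|m - e|] the second. *)
Lemma spiked_Lnorm_le e u (q : \bar R) : (0 < q)%E -> 0 <= u ->
    ('N[P]_q[EFin \o (fun w => Y w - e)%R] <= (u * a)%:E)%E ->
    `|m - e| <= u * (1 - a) ->
  ('N[P]_q[EFin \o (fun w => Y' w - e)%R] <= (u * bernoulli_norm a q)%:E)%E.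
Proof.
case: q => [s s0|_|//] u0 Yu mu.
  rewrite lte_fin in s0.
  rewrite -(@poweRKV 'N[P]_s%:E[_] s) ?Lnorm_ge0 ?gt_eqF//.
  rewrite (spiked_Lnorm (ltW a0) (ltW a1) YY')//.
  have -> : (u * bernoulli_norm a s%:E)%:E =
    (((1 - a) * (u * a) `^ s + a * (u * (1 - a)) `^ s)%:E `^ s^-1)%E.
    by rewrite poweR_EFin bernoulli_norm_scale.
  apply: gt0_ler_poweR; rewrite ?invr_ge0 ?(ltW s0)//.
  - rewrite in_itv/= leey andbT adde_ge0// ?mule_ge0 ?lee_fin ?poweR_ge0 ?(ltW c0)//.
    by rewrite mulr_ge0 ?powR_ge0 ?(ltW a0).
  - rewrite in_itv/= leey andbT lee_fin.
    by rewrite addr_ge0// mulr_ge0 ?powR_ge0 ?(ltW a0) ?(ltW c0).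
  rewrite [leRHS]EFinD; apply: leeD.
    rewrite EFinM lee_pmul2l ?lte_fin// -poweR_EFin.
    apply: gt0_ler_poweR; rewrite ?(ltW s0)// in_itv/= leey andbT ?Lnorm_ge0//.
    by rewrite lee_fin mulr_ge0// ltW.
  rewrite lee_fin ler_pM2l// ge0_ler_powR ?nnegrE ?(ltW s0)//.
  by rewrite mulr_ge0// ltW.
(* At [q = +oo] the larger distance decides, which is [u * (1 - a)] because [a <= 1/2]. *)
have PT : (0 < P [set: T])%E by rewrite probability_setT lte01.
move: Yu; rewrite unlock PT => Yu.
apply: (spiked_ess_sup_le YY' (x := u * (1 - a))) => //.
apply: le_trans Yu _; rewrite lee_fin ler_wpM2l//.
by have := a2; lra.
Qed.

Lemma spiked_Lnorm_ge e u s : 0 < s -> 0 <= u ->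
    ((u * a)%:E <= 'N[P]_(s%:E)[EFin \o (fun w => Y w - e)%R])%E ->
    u * (1 - a) <= `|m - e| ->
  ((u * bernoulli_norm a s%:E)%:E <=
   'N[P]_(s%:E)[EFin \o (fun w => Y' w - e)%R])%E.
Proof.
move=> s0 u0 Yu mu.
rewrite -(@poweRKV 'N[P]_s%:E[_] s) ?Lnorm_ge0 ?gt_eqF//.
rewrite (spiked_Lnorm (ltW a0) (ltW a1) YY')//.
have -> : (u * bernoulli_norm a s%:E)%:E =
  (((1 - a) * (u * a) `^ s + a * (u * (1 - a)) `^ s)%:E `^ s^-1)%E.
  by rewrite poweR_EFin bernoulli_norm_scale.
apply: gt0_ler_poweR; rewrite ?invr_ge0 ?(ltW s0)//.
- rewrite in_itv/= leey andbT lee_fin.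
  by rewrite addr_ge0// mulr_ge0 ?powR_ge0 ?(ltW a0) ?(ltW c0).
- rewrite in_itv/= leey andbT adde_ge0// ?mule_ge0 ?lee_fin ?poweR_ge0 ?(ltW c0)//.
  by rewrite mulr_ge0 ?powR_ge0 ?(ltW a0).
rewrite [leLHS]EFinD; apply: leeD.
  rewrite EFinM lee_pmul2l ?lte_fin// -poweR_EFin.
  apply: gt0_ler_poweR; rewrite ?(ltW s0)// in_itv/= leey andbT ?Lnorm_ge0//.
  by rewrite lee_fin mulr_ge0// ltW.
rewrite lee_fin ler_pM2l// ge0_ler_powR ?nnegrE ?(ltW s0)//.
by rewrite mulr_ge0// ltW.
Qed.

End fixed_spike.

(** With [t = m - E], the mean of [Y'] is [E + a * t], so the bulk lies about [a * t] away from it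
    and the spike [(1 - a) * t] away. Up to the fixed fluctuation of [Y], the centered [Y'] is [t]
    times a centered Bernoulli(a). *)
Lemma spiked_moment_class a p (q : \bar R) K (Y : {RV P >-> R}) :
    0 < a -> a <= 2^-1 -> 1 <= p -> (p%:E < q)%E ->
    bernoulli_norm a q < K * bernoulli_norm a p%:E ->
    (Y : T -> R) \in Lfun P q ->
  \forall m \near +oo, forall Y', spiked a m Y Y' -> moment_class P p q K Y'.
Proof.
move=> a0 a2 p1 pq gap YL.
have a1 : a < 1 by rewrite (le_lt_trans a2)// invf_lt1 ?ltr1n.
have q1 : (1 <= q)%E by rewrite (le_trans _ (ltW pq)).
have YL1 : (Y : T -> R) \in Lfun P 1.
  by apply: (@Lfun_subset _ _ _ P 1 q (lexx _) q1 _ q1) => //; exact: fin_num_measure.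
have mY : measurable_fun setT Y by exact: measurable_funPT.
have NYoo : ('N[P]_q[EFin \o Y] < +oo)%E.
  by move: YL; rewrite inE => /andP[_]; rewrite inE.
set E := fine 'E_P[Y].
pose N := ('N[P]_q[EFin \o (fun w => Y w - E)%R])%E.
have Noo : N \is a fin_num.
  rewrite ge0_fin_numE ?Lnorm_ge0// /N (_ : (fun w => _) = (Y \+ cst (- E))%R)//.
  rewrite (le_lt_trans (eminkowski _ _ _ _))//.
  by apply: lte_add_pinfty => //; rewrite Lnorm_cst// ltry.
set b := bernoulli_norm a q in gap *.
set bp := bernoulli_norm a p%:E in gap *.
have b0 : 0 < b by exact: bernoulli_norm_gt0.
(* By the gap [k > 1]. This is the slack for the upper bound: [k * b = K * bp] is the most that the
   class allows. *)
pose k := K * bp / b.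
have k1 : 1 < k by rewrite ltr_pdivlMr// mul1r.
near=> m => Y' YY'.
have m0 : 0 <= m by near: m; apply: nbhs_pinfty_ge; rewrite num_real.
have Em : E < m by near: m; apply: nbhs_pinfty_gt; rewrite num_real.
(* Beyond this threshold the fluctuation [N] is at most [a * (k - 1) * (m - E)], so it fits into the
   slack. *)
have Nm : E + fine N / (a * (k - 1)) <= m.
  by near: m; apply: nbhs_pinfty_ge; rewrite num_real.
have t0 : 0 < m - E by rewrite subr_gt0.
have E'E : fine 'E_P[Y'] = E + a * (m - E).
  by rewrite (spiked_expectation (ltW a0) (ltW a1) YY' YL1 m0) -/E; ring.
have NY : ('N[P]_q[EFin \o (fun w => Y w - fine 'E_P[Y'])%R] <=
    (k * (m - E) * a)%:E)%E.
  have -> : (fun w => Y w - fine 'E_P[Y']) =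
      ((fun w => Y w - E) \+ cst (- (a * (m - E))))%R.
    by apply/funext => w /=; rewrite E'E; ring.
  rewrite (le_trans (eminkowski _ _ _ _))//.
    exact: measurable_funB.
  rewrite Lnorm_cst// normrN gtr0_norm ?mulr_gt0// -/N -(fineK Noo) -EFinD lee_fin.
  move: Nm; rewrite -lerBrDl ler_pdivrMr ?mulr_gt0 ?subr_gt0//.
  rewrite [leRHS](_ : _ = k * (m - E) * a - a * (m - E)); last by ring.
  by rewrite lerBrDr.
have NC : ('N[P]_q[EFin \o centered Y'] <= (k * (m - E) * b)%:E)%E.
  apply: (spiked_Lnorm_le a0 a2 YY') => //.
  - by rewrite (lt_le_trans _ q1).
  - by rewrite mulr_ge0 ?(ltW t0)// ltW// (lt_trans ltr01).
  rewrite E'E (_ : m - _ = (m - E) * (1 - a)); last by ring.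
  have c0 : 0 < 1 - a by rewrite subr_gt0.
  rewrite gtr0_norm ?mulr_gt0// ler_pM2r//.
  by rewrite ler_peMl ?(ltW t0)// ltW.
split.
  rewrite inE; apply/andP; split; rewrite inE//=.
  rewrite /finite_norm.
  have -> : (Y' : T -> R) = (centered Y' \+ cst (fine 'E_P[Y'])).
    by apply/funext => w; rewrite /centered/= subrK.
  have mC : measurable_fun setT (centered Y').
    by apply: measurable_funB => //; exact: measurable_funPT.
  rewrite (le_lt_trans (eminkowski _ _ _ _))//.
  by apply: lte_add_pinfty; [exact: le_lt_trans NC (ltry _)|rewrite Lnorm_cst// ltry].
apply: le_trans NC _.
have K0 : 0 < K.
  have bp0 : 0 < bp by exact: bernoulli_norm_gt0.
  by have := lt_trans b0 gap; rewrite pmulr_lgt0.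
rewrite (_ : k * (m - E) * b = K * ((m - E) * bp)); last first.
  by rewrite /k; field; rewrite gt_eqF.
rewrite EFinM lee_pmul2l ?lte_fin//.
(* The lower bound uses the scale [m - E] itself: the p-norm of [Y - E Y'] dominates its 1-norm,
   hence [|E Y - E Y'| = a * (m - E)]. *)
apply: (spiked_Lnorm_ge a0 a2 YY'); rewrite ?(ltW t0) ?(lt_le_trans ltr01)//.
  have mD : measurable_fun setT (fun w => Y w - fine 'E_P[Y']).
    exact: measurable_funB.
  apply: le_trans (Lnorm1_le mD p1).
  rewrite Lnorm1.
  have iY : P.-integrable setT (EFin \o Y) by exact/Lfun1_integrable.
  have ic : P.-integrable setT (EFin \o cst (fine 'E_P[Y'])).
    by exact: finite_measure_integrable_cst.
  apply: (@le_trans _ _ `|\int[P]_w (Y w - fine 'E_P[Y'])%:E|)%E; last first.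
    by apply: le_abse_integral => //; exact/measurable_EFinP.
  under eq_integral do rewrite EFinB.
  rewrite integralB// integral_cst// /= probability_setT mule1.
  have <- : ('E_P[Y] = \int[P]_w (Y w)%:E)%E by rewrite unlock.
  rewrite -(fineK (expectation_fin_num YL1)) -/E -EFinB E'E/= lee_fin.
  rewrite (_ : E - _ = - (a * (m - E))); last by ring.
  by rewrite normrN gtr0_norm ?mulr_gt0// mulrC.
rewrite E'E (_ : m - _ = (m - E) * (1 - a)); last by ring.
exact: ler_norm.
Unshelve. all: by end_near. Qed.

End moment_class_spiked.

(** * Comparing laws up to a constant factor *)

Section scaled_law.
Context {d d' : measure_display} {T : measurableType d} {T' : measurableType d'}
  {R : realType}.
Variable mu : {measure set T -> \bar R}.

(** Finite measures that agree on a generating pi-system coincide. The restrictions to [D] and [D']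
    are there to carry the event that no sample equals the spike. *)
Lemma scaled_law_unique (G : set (set T')) (X X' : T -> T') (D D' : set T)
    (c : R) :
    (mu setT < +oo)%E -> 0 <= c ->
    measurable = <<s G >> -> setI_closed G -> G setT ->
    measurable_fun setT X -> measurable_fun setT X' ->
    measurable D -> measurable D' ->
    (forall C, G C ->
      mu (X' @^-1` C `&` D') = (c%:E * mu (X @^-1` C `&` D))%E) ->
  forall C, measurable C ->
    mu (X' @^-1` C `&` D') = (c%:E * mu (X @^-1` C `&` D))%E.
Proof.
move=> muoo c0 mG GI GT mX mX' mD mD' eqG C mC.
(* The measure structure of a pushforward has the measurability proof as a
   parameter, which unification cannot recover: hence the explicit instance. *)
pose image (E : set T) (mE : measurable E) f (mf : measurable_fun setT f) :=
  measure_function_pushforward__canonical__measure_function_Measure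
    (mrestr mu mE) mf : {measure set T' -> \bar R}.
pose m1 : {measure set T' -> \bar R} := image D' mD' X' mX'.
pose m2 : {measure set T' -> \bar R} := mscale (NngNum c0) (image D mD X mX).
apply: (@measure_unique _ _ _ G (fun=> setT) mG GI _ _ m1 m2) => //.
  by rewrite bigcup_const//; exists 0%N.
move=> _; apply: le_lt_trans muoo; apply: le_measure; rewrite ?inE//=.
by apply: measurableI => //; rewrite preimage_setT.
Qed.

End scaled_law.

(** * The sigma-algebra of sequences, and truncation *)

Section sequence_space.
Context {R : realType}.

Lemma measurable_coord i : measurable_fun setT (fun y : seqR R => y i).
Proof.
move=> _ B mB; rewrite setTI; apply: sub_sigma_algebra.
by exists i, B.
Qed.

Lemma measurable_fun_seqR {d} {T : measurableType d} (f : T -> seqR R) :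
  (forall i, measurable_fun setT (fun w => f w i)) -> measurable_fun setT f.
Proof.
move=> mf; apply: (@measurability _ _ T (seqR R) setT f (cylinders R) erefl).
move=> _ [_ [i [B [mB ->]] <-]].
exact: (mf i).
Qed.

Lemma measurable_truncate (m : option nat) :
  measurable_fun setT (truncate m : seqR R -> seqR R).
Proof.
apply: measurable_fun_seqR => i; rewrite /truncate.
by case: (reaches m i.+1); [exact: measurable_coord|exact: measurable_cst].
Qed.

(** One-coordinate cylinders are not closed under intersection; boxes are, and their preimages under
    truncation stay explicit. *)
Definition boxes : set (set (seqR R)) :=
  [set C | exists2 B : nat -> set R, (forall i, measurable (B i)) &
    C = [set y | forall i, B i (y i)]].

Lemma boxes_measurable : measurable = <<s boxes >>.
Proof.
rewrite eqEsubset; split.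
  apply: smallest_sub; first exact: smallest_sigma_algebra.
  move=> _ [i [B [mB ->]]]; apply: sub_sigma_algebra.
  exists (fun j => if j == i then B else setT) => [j|]; first by case: ifP.
  apply/seteqP; split => [y By j|y /(_ i)]; last by rewrite eqxx.
  by case: eqP => // ->.
apply: smallest_sub; first exact: sigma_algebra_measurable.
move=> _ [B mB ->].
have -> : [set y : seqR R | forall i, B i (y i)] =
    \bigcap_i ((fun y : seqR R => y i) @^-1` B i).
  by apply/seteqP; split => [y By i _|y By i]; exact: By.
apply: bigcapT_measurable => i.
by rewrite -[X in measurable X]setTI; exact: measurable_coord.
Qed.

Lemma boxes_setI : setI_closed boxes.
Proof.
move=> _ _ [A mA ->] [B mB ->]; exists (fun i => A i `&` B i) => [i|].
  exact: measurableI.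
apply/seteqP; split => [y [Ay By] i|y ABy]; first by split.
by split => i; have [] := ABy i.
Qed.

Lemma boxes_setT : boxes setT.
Proof. by exists (fun=> setT) => //; apply/seteqP; split. Qed.

(** Past [k] a truncated sequence is 0, so the tail of the box turns into a condition free of
    [y]. *)
Lemma truncate_box k (B : nat -> set R) :
  (truncate (Some k) : seqR R -> seqR R) @^-1` [set y | forall i, B i (y i)] =
  [set y | (forall i, (i < k)%N -> B i (y i)) /\
           (forall i, (k <= i)%N -> B i 0)].
Proof.
apply/seteqP; split => [y By|y [B1 B2] i]; last first.
  by rewrite /truncate /=; case: ltnP => [/B1|/B2].
split => i ik; have := By i; rewrite /truncate/=; first by rewrite ik.
by rewrite ltnNge ik.
Qed.

End sequence_space.

(** * Finite samples with and without spikes *)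

Section iid_prefix.
Context {d : measure_display} {T : measurableType d} {R : realType}.
Variable P : probability T R.

Lemma measurable_sample_path (Z : nat -> {RV P >-> R}) :
  measurable_fun setT (sample_path Z).
Proof. by apply: measurable_fun_seqR => i; exact: measurable_funPT. Qed.

Lemma prefix_probability (Z : nat -> {RV P >-> R}) k (B : nat -> set R) :
    mutually_independent Z -> (forall i, measurable (B i)) ->
  P [set w | forall i, (i < k)%N -> B i (Z i w)] =
  (\prod_(i < k) P (Z i @^-1` B i))%E.
Proof.
move=> /(_ (iota 0 k) B (iota_uniq 0 k)) + mB => /(_ mB) indep.
rewrite -(big_mkord xpredT (fun i => P (Z i @^-1` B i))) /index_iota subn0 -indep.
congr (P _); rewrite -bigcap_seq; apply/seteqP; split => [w Bw i|w Bw i ik].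
  by rewrite /= mem_iota => /Bw.
by apply: (Bw i); rewrite /= mem_iota.
Qed.

(* A spike at m is invisible on samples that avoid m. *)
Lemma spiked_prefix a m k (Y Y' : {RV P >-> R}) (Z Z' : nat -> {RV P >-> R})
    (C : set (seqR R)) :
    a <= 1 -> spiked a m Y Y' ->
    identically_distributed Y Z -> mutually_independent Z ->
    identically_distributed Y' Z' -> mutually_independent Z' ->
    measurable C ->
  let avoids (X : nat -> {RV P >-> R}) :=
    [set w | forall i, (i < k)%N -> X i w <> m] in
  let prefix (X : nat -> {RV P >-> R}) w := truncate (Some k) (sample_path X w) in
  P (prefix Z' @^-1` C `&` avoids Z') =
  (((1 - a) ^+ k)%:E * P (prefix Z @^-1` C `&` avoids Z))%E.
Proof.
move=> a1 YY' ZY iZ Z'Y' iZ' mC avoids prefix.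
have c0 : 0 <= 1 - a by rewrite subr_ge0.
have mp X : measurable_fun setT (prefix X).
  exact: (measurableT_comp (measurable_truncate (Some k)) (measurable_sample_path X)).
have mNm : measurable (~` [set m]) by exact: measurableC.
have mA X : measurable (avoids X).
  have -> : avoids X = \bigcap_(i in `I_k) (X i @^-1` (~` [set m])) by [].
  by apply: bigcap_measurableType => // i _; exact: measurable_funPTI.
move: C mC; apply: (scaled_law_unique (G := boxes)) => //.
- by rewrite /= probability_setT ltry.
- by rewrite exprn_ge0.
- exact: boxes_measurable.
- exact: boxes_setI.
- exact: boxes_setT.
move=> _ [B mB ->].
(* If 0 violates a tail side of the box, both events are empty. *)
have [B0|B0] := pselect (forall i, (k <= i)%N -> B i 0); last first.
  have E0 X : prefix X @^-1` [set y | forall i, B i (y i)] `&` avoids X = set0.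
    rewrite -[A in A `&` _]/(sample_path X @^-1`
      (truncate (Some k) @^-1` [set y | forall i, B i (y i)])) truncate_box.
    by apply/seteqP; split => // w [[_ ?]].
  by rewrite !E0 !measure0 mule0.
(* Avoiding [m] is absorbed into the sides. On a set without [m] the law of [Y'] is [1 - a] times
   that of [Y], which gives one factor per sample. *)
pose B' i := B i `\` [set m].
have mB' i : measurable (B' i) by exact: measurableD.
have E1 X : prefix X @^-1` [set y | forall i, B i (y i)] `&` avoids X =
    [set w | forall i, (i < k)%N -> B' i (X i w)].
  rewrite -[A in A `&` _]/(sample_path X @^-1`
      (truncate (Some k) @^-1` [set y | forall i, B i (y i)])) truncate_box.
  apply/seteqP; split => [w [[Bw _] Aw] i ik|w Bw]; first by split; [exact: Bw|exact: Aw].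
  by split=> [|i /Bw[]//]; split => // i /Bw[].
rewrite !E1 /= !prefix_probability//.
have step i : P (Z' i @^-1` B' i) = ((1 - a)%:E * P (Z i @^-1` B' i))%E.
  have := YY' _ (mB' i); rewrite -(ZY i _ (mB' i)) -(Z'Y' i _ (mB' i)).
  rewrite /distribution /pushforward diracE (_ : m \in B' i = false) ?mule0 ?adde0//.
  by apply/negP; rewrite inE => -[_]; apply.
elim: k {avoids prefix mp mA B0 E1} => [|k IH].
  by rewrite !big_ord0 expr0 mule1.
rewrite !big_ord_recr/= IH step exprSr EFinM.
by rewrite muleACA.
Qed.

(** It suffices to test rectangles, where independence splits off the same factor [P(U in A)] on
    both sides. *)
Lemma spiked_aux_prefix {dU : measure_display} {S : measurableType dU}
    (U : {RV P >-> S}) a m k (Y Y' : {RV P >-> R})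
    (Z Z' : nat -> {RV P >-> R}) (C : set (S * seqR R)) :
    a <= 1 -> spiked a m Y Y' -> iid_copies U Y Z -> iid_copies U Y' Z' ->
    measurable C ->
  let avoids (X : nat -> {RV P >-> R}) :=
    [set w | forall i, (i < k)%N -> X i w <> m] in
  let prefix (X : nat -> {RV P >-> R}) w :=
    (U w, truncate (Some k) (sample_path X w)) in
  P (prefix Z' @^-1` C `&` avoids Z') =
  (((1 - a) ^+ k)%:E * P (prefix Z @^-1` C `&` avoids Z))%E.
Proof.
move=> a1 YY' [ZY iZ UZ] [Z'Y' iZ' UZ'] mC avoids prefix.
have c0 : 0 <= 1 - a by rewrite subr_ge0.
have mt (X : nat -> {RV P >-> R}) :
    measurable_fun setT (truncate (Some k) \o sample_path X : T -> seqR R).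
  exact: (measurableT_comp (measurable_truncate (Some k)) (measurable_sample_path X)).
have mU : measurable_fun setT U by exact: measurable_funPT.
have mp X : measurable_fun setT (prefix X) := measurable_fun_pair mU (mt X).
have mNm : measurable (~` [set m]) by exact: measurableC.
pose N := [set y : seqR R | forall i, (i < k)%N -> y i <> m].
have mN : measurable N.
  have -> : N = \bigcap_(i in `I_k) ((fun y : seqR R => y i) @^-1` (~` [set m])) by [].
  apply: bigcap_measurableType => // i _.
  by rewrite -[X in measurable X]setTI; exact: measurable_coord.
have mA X : measurable (avoids X).
  rewrite -[avoids X]/(sample_path X @^-1` N) -[X in measurable X]setTI.
  exact: measurable_sample_path.
move: C mC; apply: (scaled_law_unique
    (G := [set A `*` B | A in measurable & B in measurable])) => //.
- by rewrite /= probability_setT ltry.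
- by rewrite exprn_ge0.
- exact: measurable_prod_measurableType.
- move=> _ _ [A1 mA1 [B1 mB1 <-]] [A2 mA2 [B2 mB2 <-]].
  exists (A1 `&` A2); first exact: measurableI.
  by exists (B1 `&` B2); [exact: measurableI|rewrite setXI].
- by exists setT => //; exists setT => //; rewrite setXTT.
move=> _ [A mA' [B mB <-]].
have E X : prefix X @^-1` (A `*` B) `&` avoids X =
    U @^-1` A `&` sample_path X @^-1` ((truncate (Some k) @^-1` B) `&` N).
  apply/seteqP; split => w /=; first by move=> [[? ?] ?].
  by move=> [? [? ?]].
have mBN : measurable (((truncate (Some k) : seqR R -> seqR R) @^-1` B) `&` N).
  apply: measurableI => //; rewrite -[X in measurable X]setTI.
  exact: measurable_truncate.
rewrite !E /= UZ// UZ'// muleCA; congr (_ * _)%E.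
exact: (spiked_prefix k a1 YY' ZY iZ Z'Y' iZ' mB).
Qed.

End iid_prefix.

(** * Bounds on lower limits *)

Section limn_einf_bounds.
Context {R : realType}.
Implicit Types (u : (\bar R)^nat) (x : \bar R).

Lemma limn_einf_ge u x :
  (\forall n \near \oo, x <= u n)%E -> (x <= limn_einf u)%E.
Proof.
move=> [N _ xu]; rewrite limn_einf_lim; apply: lime_ge; first exact: is_cvg_einfs.
near=> n; apply: le_ereal_inf_tmp => _ [k nk <-]; apply: xu => /=.
by apply: leq_trans nk; near: n; exact: nbhs_infty_ge.
Unshelve. all: by end_near. Qed.

Lemma limn_einf_le u x :
  (\forall n \near \oo, u n <= x)%E -> (limn_einf u <= x)%E.
Proof.
move=> ux; rewrite limn_einf_lim; apply: lime_le; first exact: is_cvg_einfs.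
near=> n; apply: (@le_trans _ _ (u n)); last by near: n.
by apply: ereal_inf_lbound; exists n => /=.
Unshelve. all: by end_near. Qed.

End limn_einf_bounds.

(** * Measurability along a possibly infinite sample count *)

Section option_nat_valued.
Context {d : measure_display} {T : measurableType d}.

Lemma measurable_fun_option {d'} {T' : measurableType d'}
    (N : T -> option nat) (f : T -> T') (g : option nat -> T -> T') :
    (forall o, measurable [set w | N w = o]) ->
    (forall o, measurable_fun setT (g o)) ->
    (forall w, f w = g (N w) w) ->
  measurable_fun setT f.
Proof.
move=> mN mg fg.
(* Index 0 stands for [None] and [j.+1] for [Some j], so that countably many fibres cover the
   space. *)
pose E i := [set w | N w = if i is j.+1 then Some j else None].
have mE i : measurable (E i) by exact: mN.
have -> : [set: T] = \bigcup_i E i.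
  apply/seteqP; split => // w _.
  by case Nw : (N w) => [k|]; [exists k.+1|exists 0%N].
apply/measurable_fun_bigcup => // i.
apply: (eq_measurable_fun (g (if i is j.+1 then Some j else None))).
  by move=> w; rewrite inE /E/= fg => ->.
exact: measurable_funTS.
Qed.

Lemma measurable_sample_count_eq {R : realType} (N : T -> option nat) o :
  measurable_fun setT (sample_count R \o N) -> measurable [set w | N w = o].
Proof.
move=> mN; have -> : [set w | N w = o] =
    (sample_count R \o N) @^-1` [set sample_count R o].
  apply/seteqP; split => w /=; first by move=> ->.
  case: (N w) o => [j|] [k|] //= [] /eqP.
  by rewrite eqr_nat => /eqP ->.
by rewrite -[X in measurable X]setTI; exact: mN.
Qed.

End option_nat_valued.

(** * From the discounted to the expected sample count *)

Section discounted_cost.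
Context {d : measure_display} {T : measurableType d} {R : realType}.
Variable P : probability T R.

(** The value at [None] is the limit of [c ^+ k] for [0 <= c < 1]. *)
Definition discount (c : R) (o : option nat) : \bar R :=
  if o is Some k then (c ^+ k)%:E else 0%E.

(* Jensen's inequality, in the form of the tangent of [c ^ n] at the mean. *)
Lemma expected_count_ge (N : T -> option nat) (c delta : R) :
    measurable_fun setT (sample_count R \o N) ->
    0 < c -> c < 1 -> 0 < delta ->
    (\int[P]_w discount c (N w) <= delta%:E)%E ->
  ((ln delta^-1 / - ln c)%:E <= \int[P]_w sample_count R (N w))%E.
Proof.
move=> mN c0 c1 d0 Nd.
have l0 : 0 < - ln c by rewrite oppr_gt0 ln_lt0// c0.
have n0 w : (0 <= sample_count R (N w))%E by case: (N w) => [k|] //=; rewrite lee_fin.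
have w0 w : (0 <= discount c (N w))%E.
  by case: (N w) => [k|] //=; rewrite lee_fin exprn_ge0// ltW.
have mW : measurable_fun setT (fun w => discount c (N w)).
  apply: (measurable_fun_option (N := N) (g := fun o => cst (discount c o))) => // o.
  exact: measurable_sample_count_eq mN.
set I := (\int[P]_w sample_count R (N w))%E.
have I0 : (0 <= I)%E by exact: integral_ge0.
case EI : I => [m| |]; rewrite ?leey//; last by rewrite EI in I0.
set l := - ln c in l0 *.
have m0 : 0 <= m by rewrite EI lee_fin in I0.
have cE k : c ^+ k = expR (- (l * k%:R)).
  by rewrite /l mulNr opprK mulrC expRM_natl lnK.
pose v := expR (- (l * m)).
have v0 : 0 < v by exact: expR_gt0.
(* The tangent at the mean [m] reads [c^n >= v * (1 + l * m - l * n)]. The term [v * l * n] is moved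
   across to keep both integrands nonnegative. *)
have : (\int[P]_w (v * (1 + l * m))%:E <=
    \int[P]_w (discount c (N w) + (v * l)%:E * sample_count R (N w)))%E.
  apply: ge0_le_integral => //.
  - by move=> w _; rewrite lee_fin mulr_ge0 ?ltW// ltr_wpDr// mulr_ge0// ltW.
  - by apply: emeasurable_funD => //; exact: measurable_funeM.
  move=> w _; case: (N w) => [k|] /=; last first.
    by rewrite add0e gt0_muley ?leey// lte_fin mulr_gt0.
  rewrite -EFinM -EFinD lee_fin cE.
  have -> : expR (- (l * k%:R)) = v * expR (l * m - l * k%:R).
    by rewrite /v -expRD; congr expR; ring.
  have := expR_ge1Dx (l * m - l * k%:R).
  move=> /(ler_wpM2l (ltW v0)); lra.
rewrite integral_cst//= probability_setT mule1.
rewrite ge0_integralD//; last 2 first.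
- by move=> w _; rewrite mule_ge0// lee_fin mulr_ge0 ?ltW.
- exact: measurable_funeM.
rewrite ge0_integralZl_EFin//; last by rewrite mulr_ge0 ?ltW.
rewrite -/I EI -EFinM => h.
have : ((v * (1 + l * m))%:E <= delta%:E + (v * l * m)%:E)%E.
  by apply: le_trans h _; rewrite leeD2r.
rewrite -EFinD lee_fin => vd.
have {}vd : v <= delta by lra.
rewrite lee_fin ler_pdivrMr// lnV ?posrE//.
have : ln v <= ln delta by rewrite ler_ln ?posrE.
by rewrite /v expRK; lra.
Qed.

End discounted_cost.

(** * Behaviour of an algorithm on spiked inputs *)

Section algorithm.
Context {d : measure_display} {T : measurableType d} {R : realType}.
Variable P : probability T R.
Variable C : set {RV P >-> R}.
Variable A : iid_algorithm C.

Local Notation stop := (alg_stop (i0 := A)).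
Local Notation phi := (alg_phi (i0 := A)).

Lemma reaches_eqP (o : option nat) k :
  o = Some k <-> reaches o k /\ ~~ reaches o k.+1.
Proof.
case: o => [j|] /=; last by split => [|[]].
by rewrite -ltnNge ltnS; split => [[->]//|[kj jk]]; congr Some; apply/eqP; rewrite eqn_leq jk.
Qed.

(** Stopping at [k] means reaching [k] but not [k.+1], and both are decided by [y 0, ..., y k.-1],
    which truncation keeps. *)
Lemma stop_truncate u (y : seqR R) k :
  stop (u, truncate (Some k) y) = Some k <-> stop (u, y) = Some k.
Proof.
have E i : (i <= k)%N -> reaches (stop (u, truncate (Some k) y)) i =
    reaches (stop (u, y)) i.
  case: i => [|i] ik; first by case: (stop (u, _)) (stop (u, y)) => [?|] [?|].
  apply: alg_stop_nonanticipating => j ji.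
  by rewrite /truncate/= (leq_trans ji (ltnW ik)).
have E1 : reaches (stop (u, truncate (Some k) y)) k.+1 =
    reaches (stop (u, y)) k.+1.
  by apply: alg_stop_nonanticipating => j jk; rewrite /truncate/= jk.
by rewrite !reaches_eqP E// E1.
Qed.

Section run.
Variable Z : nat -> {RV P >-> R}.

Lemma measurable_run : measurable_fun setT (fun w => (alg_aux A w, sample_path Z w)).
Proof.
apply: measurable_fun_pair; first exact: measurable_funPT.
exact: measurable_sample_path.
Qed.

Lemma measurable_used_count :
  measurable_fun setT (sample_count R \o used_samples A Z).
Proof. exact: measurableT_comp (@alg_stop_measurable _ _ _ _ _ A) measurable_run. Qed.

Lemma measurable_used_samples o : measurable [set w | used_samples A Z w = o].
Proof. exact: measurable_sample_count_eq measurable_used_count. Qed.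

Lemma measurable_output : measurable_fun setT (output A Z).
Proof.
apply: (measurable_fun_option (N := used_samples A Z)
  (g := fun o w => phi (alg_aux A w, truncate o (sample_path Z w)))) => // o.
  exact: measurable_used_samples.
apply: measurableT_comp (@alg_phi_measurable _ _ _ _ _ A) _.
apply: measurable_fun_pair; first exact: measurable_funPT.
exact: (measurableT_comp (measurable_truncate o) (measurable_sample_path Z)).
Qed.

End run.

Definition misses (eps e m : R) (Z : nat -> {RV P >-> R}) (k : nat) : set T :=
  [set w | [/\ used_samples A Z w = Some k, eps < `|output A Z w - e| &
    forall i, (i < k)%N -> Z i w <> m]].

Lemma measurable_misses eps e m Z k : measurable (misses eps e m Z k).
Proof.
have -> : misses eps e m Z k =
    [set w | used_samples A Z w = Some k] `&`
    ((fun w => `|output A Z w - e|) @^-1` `]eps, +oo[ `&`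
     \bigcap_(i in `I_k) (Z i @^-1` (~` [set m]))).
  apply/seteqP; split => [w [w1 w2 w3]|w [w1 [/= w2 w3]]].
    by split => //; split => //=; rewrite in_itv/= andbT.
  by split => //; move: w2; rewrite in_itv/= andbT.
apply: measurableI; first exact: measurable_used_samples.
apply: measurableI.
  rewrite -[X in measurable X]setTI.
  have mf : measurable_fun setT (fun w => `|output A Z w - e|).
    apply: measurableT_comp => //; apply: measurable_funB => //.
    exact: measurable_output.
  exact: mf.
apply: bigcap_measurableType => // i _; apply: measurable_funPTI.
exact: measurableC.
Qed.

Lemma trivIset_misses eps e m Z : trivIset setT (misses eps e m Z).
Proof.
apply/trivIsetP => i j _ _ ij; apply/seteqP; split => // w [[wi _ _] [wj _ _]].
by move: ij; move: wi; rewrite wj => -[->]; rewrite eqxx.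
Qed.

(** Once the rule stops at [k], the decision to stop and the output depend only on the auxiliary
    variable and the path truncated at [k], so the prefix comparison applies. *)
Lemma spiked_misses a eps e m (Y Y' : {RV P >-> R}) (Z Z' : nat -> {RV P >-> R}) k :
    a <= 1 -> spiked a m Y Y' ->
    iid_copies (alg_aux A) Y Z -> iid_copies (alg_aux A) Y' Z' ->
  P (misses eps e m Z' k) = (((1 - a) ^+ k)%:E * P (misses eps e m Z k))%E.
Proof.
move=> a1 YY' YZ YZ'.
pose G := [set x | stop x = Some k] `&` [set x | eps < `|phi x - e|].
have mG : measurable G.
  apply: measurableI.
    exact: measurable_sample_count_eq (@alg_stop_measurable _ _ _ _ _ A).
  have mf : measurable_fun setT (fun x => `|phi x - e|).
    apply: measurableT_comp => //; apply: measurable_funB => //.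
    exact: alg_phi_measurable.
  rewrite (_ : mkset _ = (fun x => `|phi x - e|) @^-1` `]eps, +oo[).
    by rewrite -[X in measurable X]setTI; exact: mf.
  by apply/seteqP; split => x /=; rewrite in_itv/= andbT.
have E X : misses eps e m X k =
    (fun w => (alg_aux A w, truncate (Some k) (sample_path X w))) @^-1` G `&`
    [set w | forall i, (i < k)%N -> X i w <> m].
  apply/seteqP; split => [w [w1 w2 w3]|w [[/= /stop_truncate w1 w2] w3]].
    by split => //; split => /=; [exact/stop_truncate|move: w2; rewrite /output w1].
  by split => //; rewrite /output /used_samples w1.
by rewrite !E; exact: (spiked_aux_prefix k a1 YY' YZ YZ' mG).
Qed.

(** Each term is the probability that the run on [Y'] misses its mean after [k] spike-free samples.
    These events are disjoint and lie in the failure event of [Y']. *)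
Lemma misses_series_le a eps delta m (Y Y' : {RV P >-> R})
    (Z : nat -> {RV P >-> R}) :
    a <= 1 -> spiked a m Y Y' -> approximating eps delta A -> C Y' ->
    iid_copies (alg_aux A) Y Z ->
  (\sum_(k <oo) ((1 - a) ^+ k)%:E * P (misses eps (fine 'E_P[Y']) m Z k)
   <= delta%:E)%E.
Proof.
move=> a1 YY' app CY' YZ; have [Z' YZ'] := alg_room A CY'.
set e := fine 'E_P[Y'].
under eq_eseriesr do rewrite -(spiked_misses eps e _ a1 YY' YZ YZ').
have mU : measurable (\bigcup_k misses eps e m Z' k).
  by apply: bigcupT_measurable => k; exact: measurable_misses.
rewrite -measure_semi_bigcup//; last 2 first.
- by move=> k; exact: measurable_misses.
- exact: trivIset_misses.
have := app Y' Z' CY' YZ'; rewrite -/e.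
set S := [set w | _].
have mS : measurable S.
  have mf : measurable_fun setT (fun w => `|output A Z' w - e|).
    apply: measurableT_comp => //; apply: measurable_funB => //.
    exact: measurable_output.
  rewrite (_ : S = (fun w => `|output A Z' w - e|) @^-1` `]-oo, eps]).
    by rewrite -[X in measurable X]setTI; exact: mf.
  by apply/seteqP; split => w; rewrite /S/= in_itv.
move=> hS; apply: (@le_trans _ _ (P (~` S))).
  apply: le_measure; rewrite ?inE//; first exact: measurableC.
  by move=> w [k _ [_ w2 _]] /=; rewrite /S/=; apply/negP; rewrite -ltNge.
rewrite probability_setC//.
have /fineK <- : P S \is a fin_num by exact: fin_num_measure.
rewrite -EFinB lee_fin; move: hS.
have /fineK <- : P S \is a fin_num by exact: fin_num_measure.
by rewrite lee_fin; lra.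
Qed.

(** Fatou's lemma as [m] grows: for a fixed outcome with [k] samples, the output and the samples are
    fixed reals, so eventually the output is far from the mean of [Y'] and no sample equals [m]. *)
Lemma discounted_cost_le a eps delta (Y : {RV P >-> R}) (Z : nat -> {RV P >-> R}) :
    0 < a -> a <= 1 -> approximating eps delta A ->
    (Y : T -> R) \in Lfun P 1 ->
    (\forall m \near +oo, exists2 Y', spiked a m Y Y' & C Y') ->
    iid_copies (alg_aux A) Y Z ->
  (\int[P]_w discount (1 - a) (used_samples A Z w) <= delta%:E)%E.
Proof.
move=> a0 a1 app YL CY' YZ; have c0 : 0 <= 1 - a by rewrite subr_ge0.
(* The mean of the spiked variable, written without reference to a particular [Y']. *)
pose e m := (1 - a) * fine 'E_P[Y] + a * m.
pose h (m : nat) k w : \bar R :=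
  (((1 - a) ^+ k)%:E * (\1_(misses eps (e m%:R) m%:R Z k) w)%:E)%E.
have h0 m k w : (0 <= h m k w)%E by rewrite mule_ge0 ?lee_fin ?exprn_ge0.
have mh m k : measurable_fun setT (h m k).
  apply: measurable_funeM; apply/measurable_EFinP.
  exact/measurable_indicP/measurable_misses.
have inth m k : (\int[P]_w h m k w =
    ((1 - a) ^+ k)%:E * P (misses eps (e m%:R) m%:R Z k))%E.
  rewrite ge0_integralZl_EFin ?exprn_ge0//.
    by rewrite integral_indic ?setIT//; exact: measurable_misses.
  by apply/measurable_EFinP; exact/measurable_indicP/measurable_misses.
pose H m w := (\sum_(k <oo) h m k w)%E.
have H0 m w : (0 <= H m w)%E by apply: nneseries_ge0 => *; exact: h0.
have mH m : measurable_fun setT (H m) by exact: ge0_emeasurable_sum.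
have Hd : (limn_einf (fun m => \int[P]_w H m w) <= delta%:E)%E.
  apply: limn_einf_le.
  have : \forall m \near \oo, exists2 Y', spiked a (m%:R : R) Y Y' & C Y'.
    exact: (@cvgr_idn R _ CY').
  apply: filterS => m [Y' YY' CY'm].
  rewrite integral_nneseries//; under eq_eseriesr do rewrite inth.
  have -> : e m%:R = fine 'E_P[Y'].
    by rewrite (spiked_expectation (ltW a0) a1 YY' YL).
  exact: misses_series_le app CY'm YZ.
apply: le_trans Hd; apply: le_trans (fatou P measurableT mH _) => //.
apply: ge0_le_integral => //.
- by move=> w _; case: used_samples => [k|] //=; rewrite lee_fin exprn_ge0.
- apply: (measurable_fun_option (N := used_samples A Z)
    (g := fun o => cst (discount (1 - a) o))) => // o.
  exact: measurable_used_samples.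
- rewrite /limn_einf; apply: measurableT_comp => //.
  apply: (measurable_fun_limn_esup (f := fun m w => (- H m w)%E)) => // m.
  exact: measurableT_comp.
move=> w _; apply: limn_einf_ge.
case Nw : (used_samples A Z w) => [k|] /=; last exact: nearW.
have near_far : \forall m \near \oo, eps < `|output A Z w - e (m%:R : R)|.
  near=> m; rewrite distrC (lt_le_trans _ (ler_norm _))//.
  rewrite ltrBrDr /e -ltrBlDl [a * _]mulrC -ltr_pdivrMr//.
  by near: m; exact: nbhs_infty_gtr.
have near_new : \forall m \near \oo, forall i, (i < k)%N -> Z i w <> (m%:R : R).
  near=> m => i ik Zm.
  (* The sum of the absolute values bounds all [k] samples at once. *)
  have : \sum_(j < k) `|Z j w| < (m%:R : R) by near: m; exact: nbhs_infty_gtr.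
  rewrite ltNge => /negP; apply.
  rewrite (bigD1 (Ordinal ik))//= -Zm (le_trans (ler_norm _))// lerDl.
  exact: sumr_ge0.
near=> m.
have <- : h m k w = ((1 - a) ^+ k)%:E.
  rewrite /h indicE mem_set ?mule1//; split => //.
    by near: m.
  by near: m.
(* The series dominates its term of index [k], the last one in the partial sum of length [k.+1]. *)
rewrite /H; apply: le_trans (nneseries_lim_ge k.+1 (fun i _ _ => h0 m i w)).
by rewrite big_nat_recr//= leeDr// sume_ge0.
Unshelve. all: by end_near. Qed.

End algorithm.

(** * Assembling the lower bound *)

Unset Implicit Arguments.
Set Strict Implicit.
Set Printing Implicit Defensive.

Theorem theorem3p7 (d : measure_display) (T : measurableType d) (R : realType)
    (P : probability T R) (p : R) (q : \bar R) (K eps delta : R)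
    (Prich : carries_all_laws P)
    (hp : 1 <= p) (hpq : (p%:E < q)%E) (hK : 1 < K)
    (heps : 0 < eps) (hdelta0 : 0 < delta) (hdelta1 : delta < 1) :
  (((2 * ln 2)^-1 * K `^ rate_exponent p q * ln delta^-1)%:E
    <= minimal_fixed_cost (moment_class P p q K) eps delta)%E.
Proof.
have p0 : 0 < p by exact: lt_le_trans hp.
have [a [a0 a2 aK gap]] := exists_heavy_weight p0 hpq hK.
have a1 : a < 1 by rewrite (le_lt_trans a2)// invf_lt1 ?ltr1n.
have q1 : (1 <= q)%E by rewrite (le_trans _ (ltW hpq)).
apply: le_ereal_inf_tmp => _ [n [n0 [A [app An]]] <-].
(* Every input [Y] of the class is shown to be costly, so the bound survives the infimum over
   inputs. *)
apply: le_trans An; apply: le_ereal_inf_tmp => _ [Y [Z [CY YZ ->]]].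
have YL1 : (Y : T -> R) \in Lfun P 1.
  have [YL _] := CY.
  by apply: (@Lfun_subset _ _ _ P 1 q (lexx _) q1 _ q1) => //; exact: fin_num_measure.
have near_class : \forall m \near +oo,
    exists2 Y', spiked a m Y Y' & moment_class P p q K Y'.
  have := spiked_moment_class a0 a2 hp hpq gap CY.1.
  apply: filterS => m Ym.
  have [Y' YY'] := exists_spiked m Y Prich (ltW a0) (ltW a1).
  by exists Y' => //; exact: Ym.
have c0 : 0 < 1 - a by rewrite subr_gt0.
have c1 : 1 - a < 1 by rewrite gtrBl.
apply: le_trans (expected_count_ge (measurable_used_count A Z) c0 c1 hdelta0
  (discounted_cost_le a0 (ltW a1) app YL1 near_class YZ)).
have l0 : 0 < - ln (1 - a) by rewrite oppr_gt0 ln_lt0// c0.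
have d0 : 0 < ln delta^-1 by rewrite ln_gt0// invf_gt1.
have ln2 : 0 < ln 2 :> R by rewrite ln_gt0// ltr1n.
rewrite lee_fin mulrC ler_pM2l//.
(* The first comparison is [K^r <= 1 / a], the second [- ln (1 - a) <= 2 * ln 2 * a]. *)
apply: (@le_trans _ _ ((2 * ln 2 * a)^-1)).
  by rewrite [leRHS]invfM ler_pM2l// invr_gt0 mulr_gt0.
rewrite lef_pV2 ?posrE ?mulr_gt0//.
exact: oppr_ln_onem_le (ltW a0) a2.
Qed.
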